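(* Let $n\geq1$ be an integer. Then $n$ is a power of $2$ (including $n=1$) if and only if $n$ is $2$-densely divisible and $n$ is not the semi-perimeter of a Pythagorean triangle. Furthermore, with $R:=\{2^m:m\in\mathbb{Z}_{\geq0}\}$ and $S$ the set of $n\geq1$ that are $2$-densely divisible and not semi-perimeters of Pythagorean triangles, the statement ''$R=S$'' is provable in $\mathbf{KR}_{2}$, i.e. $R,S\in\mathfrak{U}_{\mathbf{KR}_{2}}$ and $\gamma(R)=\gamma(S)$ where $\gamma(n)=\langle\!\langle n\rangle\!\rangle_{2}$.
   Context: $n\geq1$ is $2$-densely divisible if $\bigcup_{d\mid n}[d,2d]\subseteq\mathbb{R}$ is connected (has exactly one connected component). $n$ is the semi-perimeter of a Pythagorean triangle if there exist integers $x,y,z\geq1$ with $x^2+y^2=z^2$ and $(x+y+z)/2=n$. For $n\geq1$, let $D_n$ be the set of divisors of $n$, $2D_n=\{2d:d\in D_n\}$, and $u_1<\dots<u_k$ the elements of $D_n\triangle 2D_n$; the word $\langle\!\langle n\rangle\!\rangle_{2}=w_1\cdots w_k\in\{a,b\}^{\ast}$ has $w_i=a$ if $u_i\in D_n\setminus2D_n$ and $w_i=b$ if $u_i\in2D_n\setminus D_n$. $\mathbf{KR}_{2}$ is the triple $(\mathbb{Z}_{\geq1},\{a,b\},\gamma)$ with $\gamma(n)=\langle\!\langle n\rangle\!\rangle_{2}$, and $\mathfrak{U}_{\mathbf{KR}_{2}}$ is the smallest $\sigma$-algebra on $\mathbb{Z}_{\geq1}$ containing all sets $\gamma^{-1}(w)$,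 $w\in\{a,b\}^{\ast}$. *)

(* Defs.v *)
From mathcomp Require Import all_boot all_order all_algebra.
From mathcomp Require Import all_classical all_reals all_analysis.

Set Implicit Arguments.
Unset Strict Implicit.
Unset Printing Implicit Defensive.

Import numFieldNormedType.Exports.

Local Open Scope classical_set_scope.
Local Open Scope ring_scope.

(* For n >= 1 the union contains [1, 2], so [connected] (which also holds of
   the empty set) means exactly one connected component. *)
Definition densely_divisible2 (K : realType) (n : nat) : Prop :=
  connected (\bigcup_(d in [set d : nat | (d %| n)%N])
               [set` `[d%:R : K, 2 * d%:R]]).

Definition pythagorean_semiperimeter (n : nat) : Prop :=
  exists x y z : nat,
    [/\ (0 < x)%N, (0 < y)%N, (0 < z)%N, (x ^ 2 + y ^ 2 = z ^ 2)%N
      & (x + y + z = 2 * n)%N].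

Inductive letter : Type := letter_a | letter_b.

Definition twice_divisors (n : nat) : seq nat :=
  [seq (2 * d)%N | d <- divisors n].

(* The two filtered lists are disjoint and duplicate-free, so sorting their
   concatenation gives u_1 < ... < u_k. *)
Definition symdiff_divisors (n : nat) : seq nat :=
  sort leq ([seq u <- divisors n | u \notin twice_divisors n] ++
            [seq u <- twice_divisors n | u \notin divisors n]).

Definition kr2_word (n : nat) : seq letter :=
  [seq if u \in divisors n then letter_a else letter_b
     | u <- symdiff_divisors n].

Definition posint : Type := {n : nat | (0 < n)%N}.

Record lang_system := LangSystem {
  carrier : Type;
  alphabet : Type;
  encoding : carrier -> seq alphabet
}.

Definition lang_sigma_algebra (T : lang_system) : set (set (carrier T)) :=
  <<s [set @encoding T @^-1` [set w] | w in [set: seq (alphabet T)]] >>.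

Definition provable_eq (T : lang_system) (A B : set (carrier T)) : Prop :=
  [/\ lang_sigma_algebra A, lang_sigma_algebra B
    & @encoding T @` A = @encoding T @` B].

Definition KR2 : lang_system :=
  @LangSystem posint letter (fun n => kr2_word (val n)).

Definition powers_of_2 : set posint := [set n | exists m : nat, val n = (2 ^ m)%N].

Definition dense_non_semiperimeters (K : realType) : set posint :=
  [set n | densely_divisible2 K (val n) /\ ~ pythagorean_semiperimeter (val n)].

(* Main.v *)
Require Import Defs.
From mathcomp Require Import all_boot all_order all_algebra.
From mathcomp Require Import all_classical all_reals all_analysis.
From mathcomp Require Import zify lra.

(** Write [n = 2 ^ k * q] with [q] odd.

    Eliminating [z] from [x ^ 2 + y ^ 2 = z ^ 2] and [x + y + z = 2 n] gives
    [(2 n - x) (2 n - y) = 2 n ^ 2].  For [n = 2 ^ m] both factors are powers of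
    2 smaller than [2 ^ m.+1], so their product is at most [2 ^ (2 m)]: there is
    no solution.

    If [q > 1], let [p] be the least odd divisor of [n] greater than 1.  The
    divisors of [n] below [p] are the powers of 2 dividing [2 ^ k], so that
    connectedness of the union of the intervals [[d, 2 d]] forces
    [p < 2 ^ k.+1].  Hence [m < p < 2 m] and [m p] divides [n] for some power
    [m] of 2, and Euclid's parametrization yields a triangle.

    The letters [a] of the word of [n] correspond to the odd divisors of [n],
    so the powers of 2 are exactly the integers whose word is [ab]. *)

Import Order.TTheory GRing.Theory Num.Theory.

Local Open Scope nat_scope.

(** * Semi-perimeters, odd divisors and powers of 2 *)

Lemma odd_part (n : nat) : 0 < n -> exists q k, odd q /\ n = q * 2 ^ k.
Proof.
move=> n_gt0; have [q cop_q def_n] := pfactor_coprime (isT : prime 2) n_gt0.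
by exists q, (logn 2 n); rewrite -coprime2n.
Qed.

Lemma semiperimeter_factors {n x y z : nat} :
  x ^ 2 + y ^ 2 = z ^ 2 -> x + y + z = 2 * n ->
  (2 * n - x) * (2 * n - y) = 2 * n ^ 2.
Proof.
move=> Pyth Psum.
have -> : 2 * n - x = y + z by lia.
have -> : 2 * n - y = x + z by lia.
nia.
Qed.

Lemma pow2_not_semiperimeter (m : nat) : ~ pythagorean_semiperimeter (2 ^ m).
Proof.
move=> [x [y [z [x0 y0 z0 Pyth Psum]]]].
have prod_eq := semiperimeter_factors Pyth Psum.
rewrite -expnS -expnM -expnS in prod_eq Psum.
have bound a : a %| 2 ^ (m * 2).+1 -> a < 2 ^ m.+1 -> a <= 2 ^ m.
  move=> /(dvdn_pfactor _ _ (isT : prime 2))[i _ ->].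
  by rewrite ltn_exp2l // leq_exp2l.
have le_x : 2 ^ m.+1 - x <= 2 ^ m.
  by apply: bound; [rewrite -prod_eq dvdn_mulr | lia].
have le_y : 2 ^ m.+1 - y <= 2 ^ m.
  by apply: bound; [rewrite -prod_eq dvdn_mull | lia].
have := leq_mul le_x le_y.
by rewrite prod_eq -expnD leq_exp2l //; lia.
Qed.

(** With [r = l - m], the triangle [m ^ 2 - r ^ 2], [2 * m * r], [m ^ 2 + r ^ 2] has semi-perimeter
    [m * (m + r) = m * l]; scaling it by [n / (m * l)] gives [n]. The bounds on [l] say that
    [0 < r < m]. *)
Lemma semiperimeter_of_divisors (m l n : nat) :
  0 < n -> m < l < 2 * m -> m * l %| n -> pythagorean_semiperimeter n.
Proof.
move=> n_gt0 /andP[lt_ml lt_l2m] /dvdnP[c def_n].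
have c_gt0 : 0 < c by case: c def_n => [|//]; lia.
have [r def_l] : exists r, l = m + r by exists (l - m); lia.
have [s def_m] : exists s, m = r + s by exists (m - r); lia.
subst l m; have [r_gt0 s_gt0] : 0 < r /\ 0 < s by lia.
(* Here [r + s] is the former [m], so [s * (r + s + r)] is [m ^ 2 - r ^ 2] without truncated
   subtraction. *)
exists (c * (s * (r + s + r))), (2 * c * ((r + s) * r)),
  (c * ((r + s) ^ 2 + r ^ 2)).
by rewrite def_n; split; nia.
Qed.

Lemma pow2_bracket (p k : nat) : 1 < p -> odd p -> p < 2 ^ k.+1 ->
  exists2 j, j <= k & 2 ^ j < p < 2 * 2 ^ j.
Proof.
move=> p_gt1 p_odd lt_p; exists (trunc_log 2 p).
  rewrite -ltnS -(ltn_exp2l _ _ (isT : 1 < 2)).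
  by apply: leq_ltn_trans lt_p; apply: trunc_logP; lia.
have := trunc_logP (isT : 1 < 2) (ltnW p_gt1).
have := trunc_log_ltn p (isT : 1 < 2); rewrite expnS => -> le_p.
(* Equality would make the odd [p] a power of 2, hence 1. *)
rewrite andbT ltn_neqAle le_p andbT; apply/eqP => p_pow.
by move: p_odd p_gt1; rewrite -p_pow oddX orbF => /eqP->.
Qed.

(** The odd part of [d] is an odd divisor below [p], so minimality of [p] forces it to be 1; [d] is
    then a power of 2, coprime to [q]. *)
Lemma least_odd_divisor {q k p d : nat} :
  odd q -> (forall e, 1 < e -> odd e -> e %| q * 2 ^ k -> p <= e) ->
  d %| q * 2 ^ k -> d < p -> d %| 2 ^ k.
Proof.
move=> q_odd p_min dvd_d lt_dp.
have n_gt0 : 0 < q * 2 ^ k by rewrite muln_gt0 expn_gt0 odd_gt0.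
have d_gt0 := dvdn_gt0 n_gt0 dvd_d.
have [e [i [e_odd def_d]]] := @odd_part d d_gt0.
have e_dvd : e %| d by rewrite def_d dvdn_mulr.
have e1 : e = 1.
  apply/eqP; rewrite eqn_leq odd_gt0 // andbT leqNgt; apply/negP => e_gt1.
  have := p_min e e_gt1 e_odd (dvdn_trans e_dvd dvd_d).
  have := dvdn_leq d_gt0 e_dvd; lia.
move: dvd_d; rewrite def_d e1 mul1n Gauss_dvdr //.
by rewrite coprimeXl // coprime2n.
Qed.

(** * Connectedness of the union of intervals *)

Section DenseDivisibility.
Variable K : realType.

Local Open Scope ring_scope.

Lemma pow2_cover (m : nat) (z : K) : 1 <= z -> z <= (2 ^ m.+1)%:R ->
  exists2 i, (i <= m)%N & (2 ^ i)%:R <= z <= 2 * (2 ^ i)%:R.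
Proof.
elim: m => [|m IHm] z1 zm.
  by exists 0%N => //; rewrite z1; move: zm; rewrite expn1 expn0 mulr1.
have [zm'|zm'] := lerP z (2 ^ m.+1)%:R.
  by have [i le_i Pi] := IHm z1 zm'; exists i => //; exact: leqW.
by exists m.+1 => //; rewrite ltW //= -natrM -expnS.
Qed.

Lemma pow2_densely_divisible (m : nat) : densely_divisible2 K (2 ^ m).
Proof.
apply/connected_intervalP => x y [d /= dvd_d] + [e /= dvd_e] + z.
rewrite !in_itv /= => /andP[dx _] /andP[_ ye] /andP[xz zy].
have d_gt0 : (0 < d)%N by apply: dvdn_gt0 dvd_d; rewrite expn_gt0.
have le_e : (e <= 2 ^ m)%N by apply: dvdn_leq => //; rewrite expn_gt0.
have z1 : 1 <= z.
  by apply: le_trans (le_trans dx xz); rewrite ler1n.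
have zm : z <= (2 ^ m.+1)%:R.
  apply: le_trans (le_trans zy ye) _.
  by rewrite -natrM ler_nat expnS leq_mul2l.
have [i le_i Pi] := pow2_cover m z z1 zm.
by exists (2 ^ i)%N => /=; [rewrite dvdn_exp2l | rewrite in_itv].
Qed.

Lemma densely_divisible_no_gap (n a p : nat) : (0 < n)%N ->
  densely_divisible2 K n -> (p %| n)%N ->
  (forall d, d %| n -> d < p -> d <= a)%N -> (1 < p)%N -> (p <= 2 * a)%N.
Proof.
move=> n_gt0 /connected_intervalP itv_n dvd_p gap p_gt1.
(* The divisor 1 is below [p]. *)
have a_gt0 : (0 < a)%N by apply: gap.
rewrite leqNgt; apply/negP => lt_ap.
have lt_apK : 2 * a%:R + 1 <= p%:R :> K by rewrite -natrM natr1 ler_nat.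
have a1 : 1 <= a%:R :> K by rewrite ler1n.
have p0 : 0 <= p%:R :> K by [].
(* This point lies between the points 1 and [p] of the union, yet no interval contains it: those
   with [d < p] end by [2 * a], the others start at [p >= 2 * a + 1]. *)
pose z : K := 2 * a%:R + 2^-1.
case: (itv_n 1 p%:R _ _ z).
- by exists 1%N; rewrite /= ?dvd1n // in_itv /= lexx mulr1; lra.
- by exists p; rewrite //= in_itv /= lexx /=; lra.
- by rewrite /z; apply/andP; split; lra.
move=> d /= dvd_d; rewrite in_itv /= /z => /andP[dz zd].
have lt_dp : (d < p)%N by rewrite -(ltr_nat K); lra.
have : d%:R <= a%:R :> K by rewrite ler_nat gap.
lra.
Qed.

Lemma dense_semiperimeter (n : nat) : (0 < n)%N -> densely_divisible2 K n ->
  (exists m, n = 2 ^ m)%N \/ pythagorean_semiperimeter n.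
Proof.
move=> n_gt0 dense_n; have [q [k [q_odd def_n]]] := @odd_part n n_gt0.
have [q1|q_neq1] := eqVneq q 1%N.
  by left; exists k; rewrite def_n q1 mul1n.
right; pose P d := [&& 1 < d, odd d & d %| n]%N.
have exP : exists d, P d.
  exists q; rewrite /P q_odd def_n dvdn_mulr // ltn_neqAle eq_sym q_neq1.
  by rewrite odd_gt0.
case: (ex_minnP exP) => p /and3P[p_gt1 p_odd p_dvd] p_min.
have below d : (d %| n -> d < p -> d <= 2 ^ k)%N.
  move=> dvd_d lt_dp; apply: dvdn_leq; first by rewrite expn_gt0.
  apply: (least_odd_divisor q_odd _ _ lt_dp); last by rewrite -def_n.
  by move=> e e1 e_odd e_dvd; apply: p_min; rewrite /P e1 e_odd def_n.
have le_p := densely_divisible_no_gap n _ p n_gt0 dense_n p_dvd below p_gt1.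
(* The bound becomes strict because [p] is odd. *)
have lt_p : (p < 2 ^ k.+1)%N.
  rewrite expnS ltn_neqAle le_p andbT; apply: contraTneq p_odd => ->.
  by rewrite oddM.
have [j le_jk jp] := pow2_bracket p k p_gt1 p_odd lt_p.
apply: (semiperimeter_of_divisors (2 ^ j) p n n_gt0 jp).
rewrite Gauss_dvd; last by rewrite coprimeXl // coprime2n.
by rewrite p_dvd andbT def_n dvdn_mull // dvdn_exp2l.
Qed.

Lemma pow2_dense_non_semiperimeter (n : nat) : (0 < n)%N ->
  (exists m : nat, n = (2 ^ m)%N) <->
  densely_divisible2 K n /\ ~ pythagorean_semiperimeter n.
Proof.
move=> n_gt0; split=> [[m ->]|[/(dense_semiperimeter n n_gt0)[] //]].
by split; [exact: pow2_densely_divisible | exact: pow2_not_semiperimeter].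
Qed.

End DenseDivisibility.

(** * Words and their letters *)

Lemma mem_twice_divisors (n u : nat) : 0 < n ->
  (u \in twice_divisors n) = ~~ odd u && (u./2 %| n).
Proof.
move=> n_gt0; apply/mapP/andP => [[d]|[u_even dvd_u]].
  by rewrite -dvdn_divisors // => dvd_d ->; rewrite mul2n odd_double doubleK.
exists u./2; first by rewrite -dvdn_divisors.
by rewrite mul2n even_halfK.
Qed.

(** An even divisor [u] is twice the divisor [u./2], so exactly the odd ones survive. *)
Lemma mem_divisors_diff_twice (n u : nat) : 0 < n ->
  (u \in [seq u <- divisors n | u \notin twice_divisors n]) =
  odd u && (u %| n).
Proof.
move=> n_gt0; rewrite mem_filter mem_twice_divisors // -dvdn_divisors //.
case: (boolP (odd u)) => //= u_even; apply/andP => -[/negP] no_half dvd_u.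
by case: no_half; apply: dvdn_trans dvd_u; rewrite -{2}(even_halfK u_even)
  -muln2 dvdn_mulr.
Qed.

Lemma twice_divisors_uniq (n : nat) : uniq (twice_divisors n).
Proof. by rewrite map_inj_uniq ?divisors_uniq // => x y; lia. Qed.

Definition is_letter_a (l : letter) : bool :=
  if l is letter_a then true else false.

Lemma count_letter_a (n : nat) :
  count is_letter_a (kr2_word n) =
  size [seq u <- divisors n | u \notin twice_divisors n].
Proof.
rewrite /kr2_word count_map (@eq_count _ _ (mem (divisors n))); last first.
  by move=> u /=; case: (u \in divisors n).
rewrite /symdiff_divisors count_sort count_cat.
rewrite [X in _ + X](_ : _ = 0) ?addn0; last first.
  apply/eqP; rewrite -leqn0 leqNgt -has_count; apply/hasPn => u.
  by rewrite mem_filter => /andP[].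
apply/eqP; rewrite -all_count; apply/allP => u.
by rewrite mem_filter => /andP[].
Qed.

Lemma kr2_word_pow2 (m : nat) : kr2_word (2 ^ m) = [:: letter_a; letter_b].
Proof.
have n_gt0 : 0 < 2 ^ m by rewrite expn_gt0.
have odd_dvd u : odd u && (u %| 2 ^ m) = (u == 1).
  apply/andP/eqP => [[u_odd /(dvdn_pfactor _ _ (isT : prime 2))[i _ def_u]]|->];
    last by rewrite dvd1n.
  by move: u_odd; rewrite def_u oddX orbF => /eqP->.
have part_a :
    [seq u <- divisors (2 ^ m) | u \notin twice_divisors (2 ^ m)] = [:: 1].
  (* A permutation of a one-element list is that list. *)
  apply: perm_small_eq => //; apply: uniq_perm => //.
    by rewrite filter_uniq ?divisors_uniq.
  by move=> u; rewrite mem_divisors_diff_twice // odd_dvd inE.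
have pow_notin : 2 ^ m.+1 \notin divisors (2 ^ m).
  by rewrite -dvdn_divisors // dvdn_Pexp2l // ltnn.
have part_b :
    [seq u <- twice_divisors (2 ^ m) | u \notin divisors (2 ^ m)]
    = [:: 2 ^ m.+1].
  apply: perm_small_eq => //; apply: uniq_perm => //.
    by rewrite filter_uniq ?twice_divisors_uniq.
  move=> u; rewrite mem_filter inE; apply/andP/eqP => [[]|->].
    move=> + /mapP[d]; rewrite -!dvdn_divisors // => + + def_u.
    rewrite def_u => + /(dvdn_pfactor _ _ (isT : prime 2))[i le_i def_d].
    rewrite def_d -expnS dvdn_Pexp2l // -ltnNge ltnS => le_mi.
    by congr (2 ^ _.+1); apply/eqP; rewrite eqn_leq le_i.
  by split=> //; rewrite expnS map_f // -dvdn_divisors.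
rewrite /kr2_word /symdiff_divisors part_a part_b sorted_sort //=.
- by rewrite -dvdn_divisors // dvd1n (negbTE pow_notin).
- exact: leq_trans.
- by rewrite expn_gt0.
Qed.

Lemma kr2_word_ab (n : nat) : 0 < n ->
  kr2_word n = [:: letter_a; letter_b] -> exists m, n = 2 ^ m.
Proof.
move=> n_gt0 /(congr1 (count is_letter_a)); rewrite count_letter_a /= => size_a.
have [q [k [q_odd def_n]]] := @odd_part n n_gt0.
exists k; rewrite [LHS]def_n; have [->|q_neq1] := eqVneq q 1; first by rewrite mul1n.
(* Otherwise 1 and [q] are two distinct odd divisors, whereas the word has a single [a]. *)
have /uniq_leq_size : uniq [:: 1; q] by rewrite /= inE eq_sym q_neq1.
move=> /(_ [seq u <- divisors n | u \notin twice_divisors n]).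
rewrite size_a => le_size; suff /le_size : {subset [:: 1; q]
  <= [seq u <- divisors n | u \notin twice_divisors n]} by [].
move=> u; rewrite !inE mem_divisors_diff_twice // => /orP[]/eqP->; first by rewrite dvd1n.
by rewrite q_odd def_n dvdn_mulr.
Qed.

Local Open Scope classical_set_scope.

(** This exhibits the powers of 2 as one of the generators of the sigma-algebra. *)
Lemma powers_of_2_preimage :
  powers_of_2 = @encoding KR2 @^-1` [set [:: letter_a; letter_b]].
Proof.
apply/seteqP; split => -[n n_gt0]; rewrite /powers_of_2 /=.
  by move=> [m ->]; exact: kr2_word_pow2.
exact: kr2_word_ab.
Qed.

Theorem theorem26 (K : realType) :
  (forall n : nat, (0 < n)%N ->
     (exists m : nat, n = (2 ^ m)%N) <->
     densely_divisible2 K n /\ ~ pythagorean_semiperimeter n) /\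
  @provable_eq KR2 powers_of_2 (dense_non_semiperimeters K).
Proof.
split=> [n n_gt0|]; first exact: pow2_dense_non_semiperimeter.
(* Once the two sets are identified, only measurability of the powers of 2 remains. *)
have <- : powers_of_2 = dense_non_semiperimeters K.
  by apply/seteqP; split => -[n n_gt0]
    /(pow2_dense_non_semiperimeter K n n_gt0).
have meas : @lang_sigma_algebra KR2 powers_of_2.
  apply: sub_gen_smallest; rewrite powers_of_2_preimage.
  by exists [:: letter_a; letter_b].
by split.
Qed.
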